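(* Let $\mu$ be a finite Borel measure on $\mathbb{R}$ that is continuous (has no atoms). Let $m>\varsigma\ge0$ be real numbers and assume that $$\limsup_{\epsilon\to0+}\epsilon^{-\varsigma}J_{\mu,m}(x,\epsilon)>0$$ for $\mu$-almost every $x$. Then $$\dim_H^+(\mu)\le\varsigma.$$
   Context: For $m>0$, $x\in\mathbb{R}$, $\epsilon>0$, the $m$-Borel transform of $\mu$ is $J_{\mu,m}(x,\epsilon)=\epsilon^m\int_{\mathbb{R}}\frac{d\mu(y)}{|x-y|^m+\epsilon^m}$. For $S\subset\mathbb{R}$, $\dim_H(S)$ is its Hausdorff dimension; the upper Hausdorff dimension of $\mu$ is $\dim_H^+(\mu)=\inf\{\dim_H(S): S\text{ Borel},\ \mu(S)=\mu(\mathbb{R})\}$. *)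

(* Defs.v *)
From mathcomp Require Import all_boot all_order all_algebra.
From mathcomp Require Import all_classical all_reals all_analysis.

Set Implicit Arguments.
Unset Strict Implicit.
Unset Printing Implicit Defensive.

Import Order.TTheory GRing.Theory Num.Theory.
Import numFieldNormedType.Exports.

Local Open Scope classical_set_scope.
Local Open Scope ring_scope.
Local Open Scope ereal_scope.

(* Equal to -oo on the empty set. *)
Definition ediam (R : realType) (U : set R) : \bar R :=
  ereal_sup [set `|z.1 - z.2|%:E | z in U `*` U].

(* diam(U)^s, with diam(set0)^s = 0 and, for U a singleton, 0^0 = 1; hence
   the 0-dimensional Hausdorff measure is the counting measure. *)
Definition diam_pow (R : realType) (s : R) (U : set R) : \bar R :=
  if U == set0 then 0 else ediam U `^ s.

(* Finite covers are included, since the U i may be empty. *)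
Definition delta_cover (R : realType) (delta : R) (A : set R)
    (U : nat -> set R) : Prop :=
  A `<=` \bigcup_i U i /\ forall i, ediam (U i) <= delta%:E.

Definition hausdorff_delta (R : realType) (s delta : R) (A : set R) : \bar R :=
  ereal_inf [set \sum_(i <oo) diam_pow s (U i) | U in delta_cover delta A].

(* The limit as delta -> 0+ is a supremum, since hausdorff_delta is
   nonincreasing in delta. *)
Definition hausdorff_measure (R : realType) (s : R) (A : set R) : \bar R :=
  ereal_sup [set hausdorff_delta s delta A | delta in [set delta | (0 < delta)%R]].

Definition hausdorff_dim (R : realType) (A : set R) : \bar R :=
  ereal_inf [set s%:E | s in [set s | (0 <= s)%R /\ hausdorff_measure s A = 0]].

Definition upper_hausdorff_dim (R : realType)
    (mu : set (measurableTypeR R) -> \bar R) : \bar R :=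
  ereal_inf [set hausdorff_dim S | S in
    [set S : set (measurableTypeR R) | measurable S /\ mu S = mu setT]].

Definition borel_transform (R : realType)
    (mu : {measure set (measurableTypeR R) -> \bar R}) (m x eps : R) : \bar R :=
  (eps `^ m)%:E * \int[mu]_y ((`|x - y| `^ m + eps `^ m)^-1)%:E.

(* Main.v *)
(* For t < m and D = max(|x - y|, eps) the Borel kernel is at most
   (eps / D) ^ t, hence at most eps ^ t times the dyadic sum over k of
   2 ^ (t k) 1_{B(x, 2^-k)}(y).  So if mu (B(x, 2^-k)) <= 2 ^ (- u k) for all
   large k and some u > t > s, then J_{mu,m}(x, eps) = O(eps ^ t) and the
   limsup vanishes.  Hence, for almost every x, infinitely many k violate that
   bound; the dyadic interval of level k containing x then has, together with
   its two neighbours, measure at least 2 ^ (- u k).  Weighting these intervals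
   by their measures, those of level k contribute at most
   3 mu(R) 2 ^ (- (v - u) k) to the v-dimensional Hausdorff sum, v > u, and the
   tails of this geometric series tend to 0. *)
Require Import Defs.
From mathcomp Require Import all_boot all_order all_algebra.
From mathcomp Require Import all_classical all_reals all_analysis.
From mathcomp Require Import measurable_realfun zify lra.

Import Order.TTheory GRing.Theory Num.Theory.
Import numFieldNormedType.Exports.

Local Open Scope classical_set_scope.
Local Open Scope ring_scope.
Local Open Scope ereal_scope.

(** * Powers at dyadic scales, and nonnegative series *)

Lemma powR_exprn (R : realType) (a u : R) (n : nat) :
  (0 <= a)%R -> ((a ^+ n) `^ u = (a `^ u) ^+ n)%R.
Proof. by move=> a0; rewrite -!powR_mulrn ?powR_ge0// powRAC. Qed.

Lemma powR_inv (R : realType) (a u : R) :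
  (0 <= a)%R -> (a^-1 `^ u = (a `^ u)^-1)%R.
Proof. by move=> a0; rewrite -!powR_inv1 ?powR_ge0// powRAC. Qed.

Lemma powR_exprVn (R : realType) (a u : R) (n : nat) :
  (0 <= a)%R -> ((a ^- n) `^ u = (a `^ u) ^- n)%R.
Proof. by move=> a0; rewrite powR_inv ?exprn_ge0// powR_exprn. Qed.

(** Take the least [k] satisfying the lower bound: minimality gives the upper bound, or
    [d < 2 ^- k0] does when [k = 0]. *)
Lemma dyadic_bracket (R : realType) (d : R) (k0 : nat) :
  (0 < d < 2 ^- k0)%R ->
  exists k, (2 ^- (k + k0).+1 <= d < 2 ^- (k + k0))%R.
Proof.
move=> /andP[d0 dk0].
have ex : exists k, (2 ^- (k + k0).+1 <= d)%R.
  have [N _ /(_ N (leqnn _))/= H] := near_infty_natSinv_expn_lt (PosNum d0).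
  exists N; apply/ltW; apply: le_lt_trans H.
  by rewrite div1r lef_pV2 ?posrE ?exprn_gt0// ler_weXn2l ?ler1n// leqW// leq_addr.
case: (ex_minnP ex) => -[|k] kd kmin.
  by exists 0%N; rewrite kd.
exists k.+1; rewrite kd/= ltNge; apply/negP => dk.
by have := kmin k dk; rewrite ltnn.
Qed.

Lemma nneseries_geometric_le (R : realType) (a q : R) :
  (0 <= a)%R -> (0 < q < 1)%R ->
  \sum_(k <oo) (a * q ^+ k)%:E <= (a / (1 - q))%:E.
Proof.
move=> a0 /andP[q0 q1]; apply: lime_le.
  by apply: is_cvg_nneseries => n _ _; rewrite lee_fin mulr_ge0// exprn_ge0// ltW.
apply: nearW => n; rewrite sumEFin lee_fin.
by have := geometric_le_lim n a0 q0; rewrite gtr0_norm// => /(_ q1).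
Qed.

(** Indices that code no element contribute 0, so a family over a countable type can be laid out as
    a sequence, the form that [delta_cover] requires. *)
Lemma nneseries_pickle_inv (R : realType) (T : countType) (f : T -> \bar R) :
  (forall x, 0 <= f x) ->
  \sum_(n <oo) oapp f 0 (pickle_inv n) = \esum_(x in [set: T]) f x.
Proof.
move=> f0; rewrite nneseries_esumT; last by move=> n; case: pickle_inv => /=.
pose g n : \bar R := oapp f 0 (pickle_inv n).
transitivity (\esum_(n in range (@pickle T)) g n).
  rewrite [RHS]esum_mkcond; apply: eq_esum => n _; case: ifPn => //.
  rewrite notin_setE => nT; case En: (pickle_inv n) => [x|]//=.
  have := @pickle_invK T n; rewrite En/= => xn; case: nT; by exists x.
rewrite (reindex_esum setT (range (@pickle T)) (@pickle T)); last first.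
  by apply: inj_bij => x y _ _; exact: (pcan_inj pickleK).
by apply: eq_esum => x _; rewrite /g pickleK_inv.
Qed.

(** * Bounds on the Borel kernel and the Borel transform *)

Lemma kernel_le (R : realType) (m t eps d : R) :
  (0 < m)%R -> (t <= m)%R -> (0 < eps)%R -> (0 <= d)%R ->
  ((eps `^ m) * (d `^ m + eps `^ m)^-1 <= eps `^ t * (Num.max d eps)^-1 `^ t)%R.
Proof.
move=> m0 tm e0 d0; set D := Num.max d eps.
have D0 : (0 < D)%R by rewrite lt_max e0 orbT.
have DM : (D `^ m <= d `^ m + eps `^ m)%R.
  by rewrite /D; case: (leP d eps) => _; rewrite ?lerDl ?lerDr powR_ge0.
have r0 : (0 < eps * D^-1)%R by rewrite mulr_gt0// invr_gt0.
have D1 : (0 <= D^-1)%R by rewrite invr_ge0 ltW.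
rewrite -powRM ?(ltW e0)//.
(* As [eps / D] is at most 1, lowering the exponent from [m] to [t] can only increase the power. *)
apply: (@le_trans _ _ ((eps * D^-1) `^ m)%R); last first.
  apply: ger_powR; rewrite ?r0//=.
  by rewrite ler_pdivrMr// mul1r le_max lexx orbT.
rewrite powRM ?(ltW e0)// powR_inv ?(ltW D0)//.
by rewrite ler_pM2l ?powR_gt0// lef_pV2 ?posrE// ?powR_gt0// ltr_wpDl ?powR_ge0// powR_gt0.
Qed.

(** Let [D] be the maximum of [|x - y|] and [eps]. The constant term covers [2 ^- k0 <= D].
    Otherwise [D] lies in a dyadic bracket whose term alone suffices: the lower end bounds the power
    of [D^-1], whence the successor in the exponent, and the upper end puts [y] in the ball. *)
Lemma kernel_le_dyadic (R : realType) (m t eps x y : R) (k0 : nat) :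
  (0 < m)%R -> (0 <= t <= m)%R -> (0 < eps)%R ->
  ((eps `^ m) * (`|x - y| `^ m + eps `^ m)^-1)%:E <=
  (eps `^ t)%:E * (((2 `^ t) ^+ k0)%:E + \sum_(k <oo)
     ((2 `^ t) ^+ (k + k0).+1)%:E * (\1_(ball x (2 ^- (k + k0))) y)%:E).
Proof.
move=> m0 /andP[t0 tm] e0.
have := kernel_le _ _ _ _ _ m0 tm e0 (normr_ge0 (x - y)%R).
set D := Num.max _ _ => H.
have D0 : (0 < D)%R by rewrite lt_max e0 orbT.
have DV n : (2 ^- n <= D -> D^-1 `^ t <= (2 `^ t) ^+ n)%R.
  move=> nD; rewrite -powR_exprn//; apply: ge0_ler_powR => //.
  - by rewrite nnegrE invr_ge0 ltW.
  - by rewrite nnegrE exprn_ge0.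
  - by rewrite -[leRHS]invrK lef_pV2 ?posrE ?invr_gt0 ?exprn_gt0.
apply: (@le_trans _ _ ((eps `^ t)%:E * (D^-1 `^ t)%:E)); first by rewrite -EFinM lee_fin.
apply: lee_wpmul2l; first by rewrite lee_fin powR_ge0.
have F0 k : 0 <= ((2 `^ t) ^+ (k + k0).+1)%:E * (\1_(ball x (2 ^- (k + k0))) y)%:E.
  by rewrite -EFinM lee_fin mulr_ge0// exprn_ge0// powR_ge0.
have [kD|Dk] := leP (2 ^- k0)%R D.
  apply: (@le_trans _ _ ((2 `^ t) ^+ k0)%:E); first by rewrite lee_fin DV.
  by rewrite leeDl// nneseries_ge0.
have [|k /andP[kD Dk']] := dyadic_bracket _ D k0; first by rewrite D0.
apply: (@le_trans _ _ ((2 `^ t) ^+ (k + k0).+1)%:E); first by rewrite lee_fin DV.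
apply: (@le_trans _ _ (\sum_(k <oo)
     ((2 `^ t) ^+ (k + k0).+1)%:E * (\1_(ball x (2 ^- (k + k0))) y)%:E)).
  apply: le_trans (nneseries_lim_ge k.+1 _) => //.
  rewrite big_nat_recr//= indicE mem_set ?mule1.
    by rewrite leeDr// sume_ge0.
  by rewrite /ball/=; apply: le_lt_trans Dk'; rewrite le_max lexx.
by rewrite leeDr// lee_fin exprn_ge0// powR_ge0.
Qed.

(** Integrate [kernel_le_dyadic] in [y]; by nonnegativity the series and the integral commute. *)
Lemma borel_transform_le (R : realType)
    (mu : {measure set (measurableTypeR R) -> \bar R}) (m t eps x : R)
    (k0 : nat) :
  (0 < m)%R -> (0 <= t <= m)%R -> (0 < eps)%R ->
  borel_transform mu m x eps <=
  (eps `^ t)%:E * (((2 `^ t) ^+ k0)%:E * mu setT + \sum_(k <oo)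
     ((2 `^ t) ^+ (k + k0).+1)%:E * mu (ball x (2 ^- (k + k0)))).
Proof.
move=> m0 tm e0; rewrite /borel_transform.
have p0 : (0 <= 2 `^ t :> R)%R by rewrite powR_ge0.
have mball r : measurable (ball x r : set (measurableTypeR R)).
  exact: measurable_ball.
have mind n : measurable_fun setT (fun y : measurableTypeR R =>
    ((2 `^ t) ^+ (n + k0).+1)%:E * (\1_(ball x (2 ^- (n + k0))) y)%:E).
  apply: measurable_funeM; apply/measurable_EFinP; exact: measurable_indic.
have F0 k y : 0 <= ((2 `^ t) ^+ (k + k0).+1)%:E * (\1_(ball x (2 ^- (k + k0))) y)%:E :> \bar R.
  by rewrite -EFinM lee_fin mulr_ge0// exprn_ge0.
have mS : measurable_fun setT (fun y : measurableTypeR R => \sum_(n <oo)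
    ((2 `^ t) ^+ (n + k0).+1)%:E * (\1_(ball x (2 ^- (n + k0))) y)%:E).
  by apply: ge0_emeasurable_sum.
have mK : measurable_fun setT
   (fun y : measurableTypeR R => ((`|x - y| `^ m + eps `^ m)^-1)%:E).
  apply/measurable_EFinP.
  under eq_fun do rewrite -powR_inv1 ?addr_ge0 ?powR_ge0//.
  apply: (measurableT_comp (measurable_powR _)).
  apply: measurable_funD => //.
  apply: (measurableT_comp (measurable_powR _)).
  by apply: measurableT_comp => //; apply: measurable_funB.
rewrite -ge0_integralZl_EFin ?powR_ge0//; last first.
  by move=> y _; rewrite lee_fin invr_ge0 addr_ge0 ?powR_ge0.
apply: (@le_trans _ _ (\int[mu]_y ((eps `^ t)%:E * (((2 `^ t) ^+ k0)%:E + \sum_(k <oo)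
     ((2 `^ t) ^+ (k + k0).+1)%:E * (\1_(ball x (2 ^- (k + k0))) y)%:E)))).
  apply: ge0_le_integral => //.
  - by move=> y _; rewrite -EFinM lee_fin mulr_ge0 ?invr_ge0 ?addr_ge0 ?powR_ge0.
  - exact: measurable_funeM.
  - by apply: measurable_funeM; apply: emeasurable_funD.
  - by move=> y _; rewrite -EFinM kernel_le_dyadic.
rewrite ge0_integralZl_EFin ?powR_ge0//; last 2 first.
  by move=> y _; rewrite adde_ge0 ?nneseries_ge0// lee_fin exprn_ge0.
  exact: emeasurable_funD.
apply: lee_wpmul2l; first by rewrite lee_fin powR_ge0.
rewrite ge0_integralD//=; last by move=> y _; rewrite nneseries_ge0.
rewrite integral_cst// integral_nneseries//.
apply: leeD => //; apply: lee_nneseries => [n _ _|n _]; first by apply: integral_ge0.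
rewrite ge0_integralZl_EFin ?exprn_ge0//; last first.
  apply/measurable_EFinP; exact: measurable_indic.
by rewrite integral_indic// setIT.
Qed.

Lemma ltr_powR_base2 (R : realType) (x y : R) : (x < y)%R -> (2 `^ x < 2 `^ y :> R)%R.
Proof.
move=> xy; rewrite lt_neqAle ler_powR ?ler1n ?ltW// andbT; apply/eqP => /(congr1 (@ln R)).
rewrite !ln_powR => /(mulIf _) E; move: xy; rewrite E ?ltxx//.
by rewrite gt_eqF// ln_gt0// ltr1n.
Qed.

Lemma limsup_borel_transform_le0 (R : realType)
    (mu : {finite_measure set (measurableTypeR R) -> \bar R})
    (m s t u x : R) (k0 : nat) :
  (0 <= s < t)%R -> (t <= m)%R -> (t < u)%R ->
  (forall n, (k0 <= n)%N -> mu (ball x (2 ^- n)) <= ((2 `^ u) ^- n)%:E) ->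
  limf_esup (fun eps : R =>
    (eps `^ (- s))%:E * borel_transform mu m x eps) 0^'+ <= 0.
Proof.
move=> /andP[s0 st] tm tu small.
have t0 : (0 < t)%R := le_lt_trans s0 st.
set b := (2 `^ t : R)%R; set c := (2 `^ u : R)%R.
have b0 : (0 < b)%R by rewrite powR_gt0.
have c0 : (0 < c)%R by rewrite powR_gt0.
have q0 : (0 < b / c)%R by rewrite divr_gt0.
have q1 : (b / c < 1)%R by rewrite ltr_pdivrMr// mul1r ltr_powR_base2.
set M := fine (mu setT).
have M0 : (0 <= M)%R by rewrite fine_ge0.
(* The coarse term plus the sum of a geometric series of ratio [b / c]; the extra factor [b] comes
   from the successor in the exponent of the weights. *)
pose C := (b ^+ k0 * M + b * (b / c) ^+ k0 / (1 - b / c))%R.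
have C0 : (0 <= C)%R.
  by rewrite addr_ge0// ?divr_ge0 ?subr_ge0 ?mulr_ge0 ?exprn_ge0// ?ltW.
have JC eps : (0 < eps)%R ->
    (eps `^ (- s))%:E * borel_transform mu m x eps <= (eps `^ (t - s) * C)%:E.
  move=> e0.
  rewrite [in leRHS]addrC powRD; last by rewrite (gt_eqF e0) implybT.
  rewrite -mulrA EFinM; apply: lee_wpmul2l; first by rewrite lee_fin powR_ge0.
  apply: (le_trans (borel_transform_le _ mu m t _ x k0 _ _ e0)).
  - exact: lt_le_trans tm.
  - by rewrite ltW.
  rewrite EFinM; apply: lee_wpmul2l; first by rewrite lee_fin powR_ge0.
  rewrite EFinD; apply: leeD.
    by rewrite EFinM fineK// fin_num_measure.
  apply: le_trans (nneseries_geometric_le _ _ (b / c)%R _ _); last 2 first.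
  - by rewrite mulr_ge0 ?exprn_ge0 ?ltW.
  - by rewrite q0.
  apply: lee_nneseries => [n _ _|n _].
    by rewrite mule_ge0// lee_fin exprn_ge0// ltW.
  apply: (@le_trans _ _ ((b ^+ (n + k0).+1)%:E * (c ^- (n + k0))%:E)).
    by apply: lee_wpmul2l; [rewrite lee_fin exprn_ge0// ltW | apply: small; rewrite leq_addl].
  rewrite -EFinM lee_fin exprS -!mulrA -exprVn -exprMn exprD.
  by rewrite [X in (_ * X <= _)%R]mulrC.
apply/lee_addgt0Pr => e e0; rewrite add0e.
(* Dividing by [C + 1] keeps the divisor positive even when [C] is 0. *)
have H : \forall eps \near 0^'+, (eps `^ (t - s) < e / (C + 1))%R.
  have ts : (0 < t - s)%R by rewrite subr_gt0.
  by apply: (cvgr_lt _ (powR_cvg0 ts)); rewrite divr_gt0// ltr_wpDl.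
(* [limf_esup] is an infimum of suprema over members of the filter, so one member with supremum at
   most [e] suffices. *)
pose V := [set eps : R | (0 < eps)%R /\ (eps `^ (t - s) < e / (C + 1))%R].
have FV : 0^'+ V.
  near=> eps; split; near: eps; [exact: nbhs_right_gt|exact: H].
apply: (@le_trans _ _ (ereal_sup
   [set (eps `^ (- s))%:E * borel_transform mu m x eps | eps in V])).
  by apply: ereal_inf_lbound; exists V.
apply: ge_ereal_sup => _ [eps [e1 e2] <-].
apply: (le_trans (JC _ e1)); rewrite lee_fin.
have C1 : (0 < C + 1)%R by rewrite ltr_wpDl.
move: e2; rewrite ltr_pdivlMr// => /ltW; apply: le_trans.
by rewrite ler_wpM2l ?powR_ge0// lerDl.
Unshelve. all: by end_near. Qed.

(** * Dyadic intervals and sums of their masses *)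

(** The interval from [j / 2 ^ k] to [(j + 1) / 2 ^ k], closed on the left and open on the right.
    The floor gives the index of the interval through a point and makes disjointness immediate. *)
Definition dyadic (R : realType) (k : nat) (j : int) : set (measurableTypeR R) :=
  [set x : R | Num.floor (2 ^+ k * x)%R = j].

Lemma measurable_dyadic (R : realType) k j : measurable (dyadic R k j).
Proof.
rewrite (_ : dyadic R k j = `[(2 ^- k * j%:~R)%R, (2 ^- k * (j + 1)%:~R)%R[%classic).
  exact: measurable_itv.
have p0 : (0 < 2 ^+ k :> R)%R by rewrite exprn_gt0.
apply/seteqP; split => x /=; rewrite in_itv/= ![(2 ^- k * _)%R]mulrC
    ler_pdivrMr// ltr_pdivlMr// [(x * _)%R]mulrC.
  by move=> <-; rewrite floor_le floorD1_gt.
by move=> ?; apply/eqP; rewrite floor_eq.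
Qed.

Lemma ediam_dyadic (R : realType) k j : ediam (dyadic R k j) <= (2 ^- k)%:E.
Proof.
apply: ge_ereal_sup => _ [[x y] [/= xj yj] <-] /=; rewrite lee_fin.
have p0 : (0 < 2 ^+ k :> R)%R by rewrite exprn_gt0.
have := floor_itv (2 ^+ k * x)%R; have := floor_itv (2 ^+ k * y)%R.
rewrite xj yj rmorphD/= => /andP[h1 h2] /andP[h3 h4].
rewrite -(ler_pM2l p0) mulfV ?gt_eqF// -[X in (X * _)%R](gtr0_norm p0) -normrM.
by rewrite mulrBr ler_norml; apply/andP; split; lra.
Qed.

(** After scaling by [2 ^ k] the two points are less than 1 apart, so their floors differ by at most
    1. *)
Lemma ball_sub_dyadic (R : realType) k (x : R) (j := Num.floor (2 ^+ k * x)%R) :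
  ball x (2 ^- k) `<=` dyadic R k (j - 1) `|` dyadic R k j `|` dyadic R k (j + 1).
Proof.
move=> y; rewrite /ball/= => xy.
have p0 : (0 < 2 ^+ k :> R)%R by rewrite exprn_gt0.
move: xy; rewrite -(ltr_pM2l p0) mulfV ?gt_eqF// -[X in (X * _)%R](gtr0_norm p0) -normrM.
rewrite mulrBr ltr_norml => /andP[h1 h2].
have := floor_itv (2 ^+ k * x)%R; rewrite -/j rmorphD/= => /andP[h3 h4].
have l1 : (j - 1 <= Num.floor (2 ^+ k * y)%R)%R.
  by rewrite floor_ge_int rmorphB/=; lra.
have l2 : (Num.floor (2 ^+ k * y)%R < j + 2)%R.
  by rewrite floor_lt_int rmorphD/=; lra.
rewrite /dyadic/=.
have [->|[->|->]] : Num.floor (2 ^+ k * y)%R = (j - 1)%R \/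
  Num.floor (2 ^+ k * y)%R = j \/ Num.floor (2 ^+ k * y)%R = (j + 1)%R by lia.
by left; left. by left; right. by right.
Qed.

(** [esum] is a supremum over finite subfamilies, and each of these obeys the bound by finite
    additivity and monotonicity. *)
Lemma esum_measure_le (d : measure_display) (T : measurableType d) (R : realType)
    (mu : {measure set T -> \bar R}) (I : choiceType) (F : I -> set T) (c : R) :
  (0 <= c)%R -> (forall i, measurable (F i)) -> trivIset setT F ->
  \esum_(i in [set: I]) (c%:E * mu (F i)) <= c%:E * mu setT.
Proof.
move=> c0 mF tF; apply: ge_ereal_sup => _ [A [finA _] <-].
rewrite -ge0_mule_fsumr//; apply: lee_wpmul2l => //.
rewrite -measure_fin_bigcup//; last exact: sub_trivIset tF.
by apply: le_measure; rewrite ?inE//; apply: fin_bigcup_measurable.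
Qed.

(** Bounds the masses of all balls of radius [2 ^- k] centred in the middle interval by a quantity
    depending on the index only. *)
Definition dyadic3 (R : realType) (mu : set (measurableTypeR R) -> \bar R) k j :=
  mu (dyadic R k (j - 1)) + mu (dyadic R k j) + mu (dyadic R k (j + 1)).

Lemma esum_dyadic3_le (R : realType)
    (mu : {measure set (measurableTypeR R) -> \bar R}) (c : R) k :
  (0 <= c)%R ->
  \esum_(j in [set: int]) (c%:E * dyadic3 R mu k j) <=
  c%:E * (mu setT + mu setT + mu setT).
Proof.
move=> c0; rewrite /dyadic3.
have c0' : 0 <= c%:E by rewrite lee_fin.
under eq_esum do rewrite !ge0_muleDr ?adde_ge0//.
rewrite !esumD; do ?[by move=> *; rewrite ?adde_ge0 ?mule_ge0].
rewrite !ge0_muleDr ?adde_ge0//.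
(* Translating the index is injective, so each of the three shifted families is still disjoint. *)
have shift (a : int) :
    \esum_(j in [set: int]) (c%:E * mu (dyadic R k (j + a))) <= c%:E * mu setT.
  apply: esum_measure_le => // [j|]; first exact: measurable_dyadic.
  apply/trivIsetP => i j _ _ ij; apply/eqP/negPn/negP => /set0P[x [/= xi xj]].
  by move/eqP: ij; apply; apply: (addIr a); rewrite -xi -xj.
do 2?[apply: leeD] => //; have := shift 0%R.
by under eq_esum do rewrite addr0.
Qed.

Lemma measure_ball_le_dyadic3 (R : realType)
    (mu : {measure set (measurableTypeR R) -> \bar R}) k (x : R) :
  mu (ball x (2 ^- k)) <= dyadic3 R mu k (Num.floor (2 ^+ k * x)%R).
Proof.
have mD := measurable_dyadic R.
apply: (le_trans (le_measure mu _ _ (@ball_sub_dyadic R k x))).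
- by rewrite inE; exact: measurable_ball.
- by rewrite inE; do 2?[apply: measurableU].
rewrite /dyadic3; apply: (le_trans (measureU2 _ _ _)) => //; first exact: measurableU.
by apply: leeD => //; apply: measureU2.
Qed.

(** * Hausdorff sums of covers by heavy intervals *)

Lemma diam_pow0 (R : realType) (u : R) : diam_pow u set0 = 0.
Proof. by rewrite /diam_pow eqxx. Qed.

Lemma diam_pow_ge0 (R : realType) (u : R) (U : set R) : 0 <= diam_pow u U.
Proof. by rewrite /diam_pow; case: ifP => // _; exact: poweR_ge0. Qed.

Lemma diam_pow_le (R : realType) (u r : R) (U : set R) :
  (0 <= u)%R -> (0 <= r)%R -> ediam U <= r%:E -> diam_pow u U <= (r `^ u)%:E.
Proof.
move=> u0 r0 Ur; rewrite /diam_pow; case: ifPn => [_|/set0P[x Ux]].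
  by rewrite lee_fin powR_ge0.
(* Monotonicity of the power is applied on nonnegative bases; the point [x] excludes the value [-oo]
   of the empty set. *)
have U0 : 0 <= ediam U.
  by apply: ereal_sup_ubound; exists (x, x) => //=; rewrite subrr normr0.
rewrite -poweR_EFin; apply: gt0_ler_poweR => //; rewrite in_itv/= leey andbT//.
Qed.

(** The covering half of the argument: [t] and [u] here are the exponents [u] and [v] of the
    overview. *)
Lemma hausdorff_measure_eq0 (R : realType)
    (mu : {finite_measure set (measurableTypeR R) -> \bar R})
    (t u : R) (A : set R) :
  (0 <= u)%R -> (t < u)%R ->
  (forall x, A x -> forall k0, exists2 n, (k0 <= n)%N &
     ((2 `^ t) ^- n)%:E <= mu (ball x (2 ^- n))) ->
  hausdorff_measure u A = 0.
Proof.
move=> u0 tu heavy.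
set b := (2 `^ t : R)%R; set c := (2 `^ u : R)%R.
have b0 : (0 < b)%R by rewrite powR_gt0.
have c0 : (0 < c)%R by rewrite powR_gt0.
have q0 : (0 < b / c)%R by rewrite divr_gt0.
have q1 : (b / c < 1)%R by rewrite ltr_pdivrMr// mul1r ltr_powR_base2.
set q := (b / c)%R in q0 q1.
set M := fine (mu setT + mu setT + mu setT).
have MfinE : mu setT + mu setT + mu setT = M%:E.
  by rewrite /M fineK// !fin_numD !fin_num_measure.
have M0 : (0 <= M)%R by rewrite -lee_fin -MfinE !adde_ge0.
pose V n j := if ((b ^- n)%:E <= dyadic3 R mu n j) then dyadic R n j else set0.
have Vdiam n j : diam_pow u (V n j) <= (q ^+ n)%:E * dyadic3 R mu n j.
  have nu0 : 0 <= dyadic3 R mu n j by rewrite !adde_ge0.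
  rewrite /V; case: ifPn => [good|_]; last first.
    by rewrite diam_pow0 mule_ge0// lee_fin exprn_ge0// ltW.
  (* The diameter contributes at most [c ^- n = q ^ n * b ^- n], and being selected means that
     [b ^- n] is at most the mass [dyadic3]. *)
  apply: (@le_trans _ _ ((q ^+ n)%:E * (b ^- n)%:E)); last first.
    by apply: lee_wpmul2l => //; rewrite lee_fin exprn_ge0// ltW.
  apply: (le_trans (diam_pow_le _ _ _ _ u0 _ (ediam_dyadic R n j))) => //.
  rewrite -EFinM lee_fin powR_exprVn// -!exprVn -exprMn /q mulrAC divff ?mul1r//.
  by rewrite gt_eqF.
(* All selected intervals of levels at least [k0], in one sequence; the first coordinate stores the
   level minus [k0]. *)
pose U k0 i := oapp (fun p : nat * int => V (p.1 + k0)%N p.2) set0 (pickle_inv i).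
have Ucov k0 : A `<=` \bigcup_i U k0 i.
  move=> x Ax; have [n kn xn] := heavy x Ax k0.
  exists (pickle ((n - k0)%N, Num.floor (2 ^+ n * x)%R)) => //.
  rewrite /U pickleK_inv/= subnK// /V ifT//.
  exact: (le_trans xn (measure_ball_le_dyadic3 _ _ _ _)).
have Udiam k0 i : ediam (U k0 i) <= (2 ^- k0)%:E.
  have ediam0 : ediam (set0 : set R) <= (2 ^- k0)%:E.
    by apply: ge_ereal_sup => ? [z [/= []]].
  rewrite /U; case: pickle_inv => [[k j]|]//=; rewrite /V; case: ifP => // _.
  apply: (le_trans (ediam_dyadic _ _ _)).
  by rewrite lee_fin lef_pV2 ?posrE ?exprn_gt0// ler_weXn2l ?ler1n// leq_addl.
have Usum k0 : \sum_(i <oo) diam_pow u (U k0 i) <= (M * q ^+ k0 / (1 - q))%:E.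
  pose f (p : nat * int) := diam_pow u (V (p.1 + k0)%N p.2).
  have -> : \sum_(i <oo) diam_pow u (U k0 i) = \esum_(p in [set: nat * int]) f p.
    rewrite -nneseries_pickle_inv; last by move=> p; exact: diam_pow_ge0.
    apply: eq_eseriesr => i _; rewrite /U; case: pickle_inv => //=.
    exact: diam_pow0.
  rewrite (_ : [set: nat * int] = [set: nat] `*`` (fun=> [set: int])); last first.
    by apply/seteqP.
  rewrite -(esum_esum (a := fun k j => diam_pow u (V (k + k0)%N j))); last first.
    by move=> *; exact: diam_pow_ge0.
  rewrite -nneseries_esumT; last by move=> n; apply: esum_ge0 => *; exact: diam_pow_ge0.
  apply: le_trans (nneseries_geometric_le _ _ q _ _); last 2 first.
  - by rewrite mulr_ge0 ?exprn_ge0 ?(ltW q0).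
  - by rewrite q0.
  apply: lee_nneseries => [n _ _|n _]; first by apply: esum_ge0 => *; exact: diam_pow_ge0.
  (* At a fixed level the masses [dyadic3] sum to at most [M], three times the total mass, which
     leaves a geometric term. *)
  apply: (@le_trans _ _ (\esum_(j in [set: int]) ((q ^+ (n + k0))%:E * dyadic3 R mu (n + k0) j))).
    by apply: le_esum => j _; exact: Vdiam.
  apply: (le_trans (esum_dyadic3_le _ _ _ _ _)); first by rewrite exprn_ge0// ltW.
  by rewrite MfinE -EFinM lee_fin exprD mulrC -mulrA [(q ^+ k0 * _)%R]mulrC.
apply/eqP; rewrite eq_le; apply/andP; split; last first.
  (* For the lower bound the supremum needs one nonnegative member; [delta = 1] provides it. *)
  apply: ereal_sup_ge; exists (hausdorff_delta u 1 A); first by exists 1%R => /=.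
  apply: le_ereal_inf_tmp => _ [W _ <-]; apply: nneseries_ge0 => n _ _.
  exact: diam_pow_ge0.
apply: ge_ereal_sup => _ [delta /= d0 <-].
apply/lee_addgt0Pr => e e0; rewrite add0e.
have H1 : \forall k \near \oo, (2 ^- k < delta)%R.
  by apply: filterS (near_infty_natSinv_expn_lt (PosNum d0)) => k; rewrite div1r.
have H2 : \forall k \near \oo, (M / (1 - q) * q ^+ k < e)%R.
  have qn : (`|q| < 1)%R by rewrite gtr0_norm.
  exact: (cvgr_lt _ (cvg_geometric (M / (1 - q))%R qn)).
have [k [k1 k2]] : exists k, (2 ^- k < delta)%R /\ (M / (1 - q) * q ^+ k < e)%R.
  near \oo => k; exists k; split; near: k; [exact: H1|exact: H2].
apply: (@le_trans _ _ (\sum_(i <oo) diam_pow u (U k i))).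
  apply: ereal_inf_lbound; exists (U k) => //; split; first exact: Ucov.
  by move=> i; apply: (le_trans (Udiam k i)); rewrite lee_fin ltW.
by apply: (le_trans (Usum k)); rewrite lee_fin mulrAC ltW.
Unshelve. all: by end_near. Qed.

(** * Choice of the carrier and of the exponents *)

Theorem corollary1p9 (R : realType)
    (mu : {finite_measure set (measurableTypeR R) -> \bar R})
    (mu_continuous : forall x : R, mu [set x] = 0)
    (m s : R) (s_ge0 : (0 <= s)%R) (s_lt_m : (s < m)%R)
    (limsup_gt0 : {ae mu, forall x : R,
       0 < limf_esup (fun eps : R =>
             (eps `^ (- s))%:E * borel_transform mu m x eps) 0^'+}) :
  upper_hausdorff_dim mu <= s%:E.
Proof.
have [N [mN N0 subN]] := limsup_gt0.
(* The complement of a measurable null set containing every exceptional point is a Borel set of full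
   measure. *)
apply: (@le_trans _ _ (hausdorff_dim (~` N))).
  apply: ereal_inf_lbound; exists (~` N) => //; split; first exact: measurableC.
  rewrite -setTD measureD//; first by rewrite setTI [X in _ - X]N0 sube0.
  by rewrite ltey_eq fin_num_measure.
apply/lee_addgt0Pr => e e0; rewrite -EFinD.
apply: ereal_inf_lbound; exists (s + e)%R => //=; split; first by rewrite addr_ge0// ltW.
(* The exponents satisfy [s < t < s + 3e/4 < s + e]: [t] is for the kernel, [s + 3e/4] for the ball
   masses, [s + e] for the Hausdorff measure. The minimum with [m - s] ensures [t <= m]. *)
pose t := (s + Num.min (e / 2) (m - s))%R.
have ts : (s < t)%R by rewrite ltrDl lt_min divr_gt0//= subr_gt0.
have tm : (t <= m)%R by rewrite -lerBrDl ge_min lexx orbT.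
have te : (t <= s + e / 2)%R by rewrite lerD2l ge_min lexx.
have tu : (t < s + e * 3 / 4)%R by lra.
apply: (@hausdorff_measure_eq0 R mu (s + e * 3 / 4)%R) => [|| x Nx k0].
- by rewrite addr_ge0// ltW.
- by lra.
have xpos : 0 < limf_esup (fun eps : R =>
    (eps `^ (- s))%:E * borel_transform mu m x eps) 0^'+.
  by apply: contrapT => /subN.
(* If no level from [k0] on were heavy at [x], all those balls would be small and the limsup could
   not be positive. *)
apply: contrapT => none.
have := @limsup_borel_transform_le0 R mu m s t (s + e * 3 / 4)%R x k0.
rewrite s_ge0 ts tm tu => /(_ isT isT isT) h.
move: xpos; rewrite ltNge h// => n kn; rewrite leNgt; apply/negP => /ltW big.
by apply: none; exists n.
Qed.
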